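(* Let $(\tau,\xi)\in\mathbb{R}^2$ and let $\{f_n\}_{n\in\mathbb{N}_0}\subset\mathrm{F}$ be such that $f_n(\tau,\xi)>0$ for all $n$. For partitions $\{\pi_n\}_{n\in\mathbb{N}}\subset\Pi([\tau,\infty))$, let $\varphi_n:[\tau,\infty)\to\mathbb{R}$ be the forward Euler $\pi_n$-polygon for the initial value problem $x'=f_n(t,x)$, $x(\tau)=\xi$, for $n\in\mathbb{N}$, and let $\varphi_0\in C^1([\tau,T_0),\mathbb{R})$ be the unique maximal solution of the initial value problem $x'=f_0(t,x)$, $x(\tau)=\xi$. Then for any values $T\in(\tau,T_0)$ and $X\in(\varphi_0(T),\infty)$, $$\left(\Vert f_0-f_n\Vert_{[\tau,T]\times[\xi,X]},\ \Vert\pi_n\Vert_{[\tau,T]}\right)\xrightarrow{n\to\infty}(0,0)\ \implies\ \Vert\varphi_0-\varphi_n\Vert_{[\tau,T]}\xrightarrow{n\to\infty}0.$$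
   Context: $\mathrm{F}\subset C(\mathbb{R}^2,\mathbb{R})$ is the set of continuous functions $f:\mathbb{R}^2\to\mathbb{R}$, $(t,x)\mapsto f(t,x)$, such that $f(\cdot,x)$ is strictly increasing for every $x\in\mathbb{R}$, and $f(\tau,\xi)>0$ for some $(\tau,\xi)\in\mathbb{R}^2$. A maximal solution of $x'=f(t,x)$, $x(\tau)=\xi$ (going forwards in time) is a path $\varphi\in C^1([\tau,T_* ),\mathbb{R})$ for some $T_*\in(\tau,\infty]$ which verifies $\varphi(\tau)=\xi$, $\varphi'(t)=f(t,\varphi(t))$ for every $t\in[\tau,T_* )$, and $T_*\vee\sup_{t\in[\tau,T_* )}|\varphi(t)|=\infty$. When $f\in\mathrm{F}$ and $f(\tau,\xi)>0$ such a maximal solution exists and is unique. A partition $\pi\in\Pi([\tau,\infty))$ is an unbounded set $\pi=\{t_k\}_{k\in\mathbb{N}_0}\subset[\tau,\infty)$ with $\tau=t_0<t_1<t_2<\cdots$. Its mesh over $[\tau,T]$ is $\Vert\pi\Vert_{[\tau,T]}:=\max_{k\in\mathbb{N}_0}\{t_{k+1}\wedge T-t_k\wedge T\}$. The forward Euler $\pi$-polygon for $x'=f(t,x)$, $x(\tau)=\xi$ is the (piecewise linear, continuous) path $\varphi_\pi:[\tau,\infty)\to\mathbb{R}$ with $\varphi_\pi(\tau):=\xi$ and, recursively over each interval $(t_k,t_{k+1}]$, $\varphi_\pi(t):=\varphi_\pi(t_k)+(t-t_k)f(t_k,\varphi_\pi(t_k))$. Norms: $\Vert f\Vert_{[\tau,T]\times[\xi,X]}:=\sup\{|f(t,x)|:(t,x)\in[\tau,T]\times[\xi,X]\}$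 and $\Vert\varphi\Vert_{[\tau,T]}:=\sup_{t\in[\tau,T]}|\varphi(t)|$. *)

(* Defs.v *)
(* MathComp-Analysis; the real line is an arbitrary [R : realType]. A path on
   an interval is a total function [R -> R] of which only the values on that
   interval matter. *)
From HB Require Import structures.
From mathcomp Require Export all_boot all_order all_algebra.
From mathcomp Require Export all_classical all_reals all_analysis.
Set Implicit Arguments.
Unset Strict Implicit.
Unset Printing Implicit Defensive.
Export Order.TTheory GRing.Theory Num.Theory.
Export numFieldNormedType.Exports.
#[global] Open Scope classical_set_scope.
#[global] Open Scope ring_scope.

Definition classF (R : realType) : set (R * R -> R) :=
  [set f : R * R -> R | [/\ continuous f,
               forall x : R, {homo (fun t => f (t, x)) : s t / s < t} &
               exists p : R * R, 0 < f p]].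
Arguments classF R : clear implicits.

(* Valued in [\bar R], so that the supremum is meaningful for unbounded
   functions too. *)
Definition sup_norm (R : realType) (T : Type) (A : set T) (f : T -> R) :
    \bar R :=
  ereal_sup [set `|f x|%:E | x in A].

(* [d] is the derivative of [phi] at [t] relative to [D]: at the left endpoint
   of [tau, T[ this is the right derivative. *)
Definition has_derivative_within (R : realType) (D : set R) (phi : R -> R)
    (t d : R) : Prop :=
  (phi s - phi t) / (s - t) @[s --> within D t^'] --> d.

Definition C1_on (R : realType) (D : set R) (phi : R -> R) : Prop :=
  exists dphi : R -> R,
    {within D, continuous dphi} /\
    forall t, D t -> has_derivative_within D phi t (dphi t).

(* The interval [tau, T[ with a possibly infinite right endpoint. *)
Definition forward_itv (R : realType) (tau : R) (T : \bar R) : set R :=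
  [set t | tau <= t /\ (t%:E < T)%E].

Definition maximal_solution (R : realType) (f : R * R -> R) (tau xi : R)
    (T : \bar R) (phi : R -> R) : Prop :=
  [/\ (tau%:E < T)%E,
      C1_on (forward_itv tau T) phi,
      phi tau = xi,
      forall t, forward_itv tau T t ->
        has_derivative_within (forward_itv tau T) phi t (f (t, phi t)) &
      maxe T (sup_norm (forward_itv tau T) phi) = +oo%E].

(* A partition is given by its increasing enumeration, which is unique. *)
Definition is_partition (R : realType) (tau : R) (p : nat -> R) : Prop :=
  [/\ p 0%N = tau,
      forall k, p k < p k.+1 &
      forall M : R, exists k, M < p k].

(* The supremum is a maximum: only finitely many terms are nonzero. *)
Definition mesh (R : realType) (p : nat -> R) (T : R) : \bar R :=
  ereal_sup (range (fun k => (Num.min (p k.+1) T - Num.min (p k) T)%:E)).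

(* These equations determine [phi] on [tau, +oo[. *)
Definition euler_polygon (R : realType) (f : R * R -> R) (tau xi : R)
    (p : nat -> R) (phi : R -> R) : Prop :=
  phi tau = xi /\
  forall k t, p k < t <= p k.+1 ->
    phi t = phi (p k) + (t - p k) * f (p k, phi (p k)).

(* Main.v *)
Require Import Defs.
From mathcomp Require Import lra.
Set Implicit Arguments.
Unset Strict Implicit.
Unset Printing Implicit Defensive.

(* Since [f_0] is strictly increasing in time, the time shifts
   [t |-> phi_0 (t + delta)] and [t |-> phi_0 (t - delta)], with [phi_0]
   extended by [xi] to the left of [tau], are a strict super- and a strict
   subsolution of [x' = f_0(t, x)], with a gap bounded below by compactness.
   An Euler polygon with small mesh and [f_n] close to [f_0] follows the field
   [f_0] up to an error smaller than this gap, hence it can never cross either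
   shift. The shifts converge uniformly to [phi_0] as [delta] tends to [0]. *)

(** * Right derivatives and barrier arguments *)

(** One-sided slopes are enough for comparison, and they survive the kink of the extended solution
    at [tau], where the slope jumps from 0 to [f (tau, xi)]. *)
Definition right_derivative (R : realType) (phi : R -> R) (s d : R) : Prop :=
  (phi (s + e) - phi s) / e @[e --> 0^'+] --> d.

Lemma right_derivative_shift (R : realType) (phi : R -> R) (c s d : R) :
  right_derivative phi (s + c) d -> right_derivative (fun t => phi (t + c)) s d.
Proof. by rewrite /right_derivative; under eq_fun do rewrite addrAC. Qed.

Lemma right_derivativeN (R : realType) (phi : R -> R) (s d : R) :
  right_derivative phi s d -> right_derivative (fun t => - phi t) s (- d).
Proof.
move=> /cvgN; apply: cvg_trans; apply: near_eq_cvg; near=> e.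
by rewrite !fctE -mulNr opprD.
Unshelve. all: by end_near. Qed.

Lemma right_derivative_gt (R : realType) (phi : R -> R) (s d c : R) :
  right_derivative phi s d -> c < d ->
  \forall e \near 0^'+, phi s + c * e < phi (s + e).
Proof.
move=> /cvgr_gt dphi /dphi; apply: filterS2 (nbhs_right_gt (0 : R)) => e e0.
by rewrite ltr_pdivlMr// ltrBrDl.
Qed.

(** If [h t < 0], consider the supremum of the times up to [t] at which [h >= 0]. By continuity [h]
    vanishes there, yet it is negative immediately afterwards, which the crossing hypothesis
    forbids. *)
Lemma ge0_of_no_downcrossing (R : realType) (h : R -> R) (a b : R) :
  continuous h -> 0 <= h a ->
  (forall s, a <= s < b -> h s = 0 -> \forall e \near 0^'+, 0 <= h (s + e)) ->
  forall t, a <= t <= b -> 0 <= h t.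
Proof.
move=> hc ha cross t /andP[leat letb]; rewrite leNgt; apply/negP => ht.
pose A : set R := [set u | a <= u <= t /\ 0 <= h u].
have supA : has_sup A.
  split; first by exists a; split=> //; rewrite lexx.
  by exists t => u [/andP[]].
have [leac lect] : a <= sup A /\ sup A <= t.
  split; first by apply: sup_ubound; [exact: supA.2|split=> //; rewrite lexx].
  by apply: ge_sup; [exact: supA.1|move=> u [/andP[]]].
have hneg u : sup A < u -> u <= t -> h u < 0.
  move=> ltu leu; rewrite ltNge; apply/negP => hu.
  suff : u <= sup A by rewrite leNgt ltu.
  apply: sup_ubound; first exact: supA.2.
  by split=> //; rewrite leu (le_trans leac (ltW ltu)).
have hc_ge0 : 0 <= h (sup A).
  rewrite leNgt; apply/negP => hlt.
  have : \forall x \near sup A, h x < 0 by have /cvgr_lt := hc (sup A); apply.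
  move=> /nbhs_ballP[e /= e0 he].
  have [u [uI hu] ltu] := sup_adherent e0 supA.
  suff : h u < 0 by rewrite ltNge hu.
  apply: he => /=; have uA : u <= sup A by exact: sup_ubound supA.2 _ _.
  by rewrite /ball /= ger0_norm; lra.
have ltct : sup A < t.
  by rewrite lt_neqAle lect andbT; apply/eqP => E; move: ht; rewrite -E ltNge hc_ge0.
have near_lt : \forall e \near (0 : R)^'+, h (sup A + e) < 0.
  near=> e; apply: hneg.
    by rewrite ltrDl; near: e; exact: nbhs_right_gt.
  rewrite -lerBrDl; near: e; apply: nbhs_right_le; lra.
have hc_le0 : h (sup A) <= 0.
  have lim : h (sup A + e) @[e --> (0 : R)^'+] --> h (sup A).
    apply: cvg_at_right_filter; rewrite -[X in _ --> h X]addr0.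
    apply: (@continuous_comp _ _ _ (fun e => sup A + e) h); last exact: hc.
    by apply: cvgD; [exact: cvg_cst|exact: cvg_id].
  apply: (cvgr_to_le lim); near=> e; apply: ltW; near: e; exact: near_lt.
have near_ge : \forall e \near (0 : R)^'+, 0 <= h (sup A + e).
  apply: cross; first by rewrite leac (lt_le_trans ltct).
  by apply/eqP; rewrite eq_le hc_le0.
by have [e []] := filter_ex (filterI near_lt near_ge); rewrite ltNge => /negbTE->.
Unshelve. all: by end_near. Qed.

(** Slopes are compared only at times of contact, where curve and line share the same point of the
    plane. Strictness of [d < g] keeps the curve above the line just after contact. *)
Lemma curve_ge_line (R : realType) (psi : R -> R) (a b y d : R) :
  continuous psi -> y <= psi a ->
  (forall s, a <= s < b -> psi s = y + d * (s - a) ->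
    exists2 g, right_derivative psi s g & d < g) ->
  forall t, a <= t <= b -> y + d * (t - a) <= psi t.
Proof.
move=> psic psia touch t tab; rewrite -subr_ge0.
apply: (@ge0_of_no_downcrossing _ (fun t => psi t - (y + d * (t - a))) a b) => //.
- move=> s; apply: cvgB; first exact: psic.
  apply: cvgD; first exact: cvg_cst.
  apply: cvgM; first exact: cvg_cst.
  by apply: cvgB; [exact: cvg_id|exact: cvg_cst].
- by rewrite subrr mulr0 addr0 subr_ge0.
- move=> s sab /eqP; rewrite subr_eq0 => /eqP E.
  have [g dg ltg] := touch s sab E.
  apply: filterS (right_derivative_gt dg ltg) => e; rewrite E; lra.
Qed.

Lemma curve_le_line (R : realType) (psi : R -> R) (a b y d : R) :
  continuous psi -> psi a <= y ->
  (forall s, a <= s < b -> psi s = y + d * (s - a) ->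
    exists2 g, right_derivative psi s g & g < d) ->
  forall t, a <= t <= b -> psi t <= y + d * (t - a).
Proof.
move=> psic psia touch t tab.
suff : - y + - d * (t - a) <= - psi t by lra.
apply: (@curve_ge_line _ (fun t => - psi t) a b) => //.
- by move=> s; apply: cvgN; exact: psic.
- by rewrite lerN2.
move=> s sab E; have [|g dg ltg] := touch s sab; first lra.
by exists (- g); [exact: right_derivativeN|rewrite ltrN2].
Qed.

(* A level crossed upwards at time [s], where [f (s, x) >= 0], cannot be crossed
   downwards later, where [f (_, x) > 0]. *)
Lemma solution_nondecreasing (R : realType) (f : R * R -> R) (u : R -> R)
    (tau T : R) :
  (forall x, {homo (fun t => f (t, x)) : s t / s < t}) ->
  0 < f (tau, u tau) -> continuous u ->
  (forall t, tau <= t < T -> right_derivative u t (f (t, u t))) ->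
  forall a b, tau <= a -> a <= b -> b <= T -> u a <= u b.
Proof.
move=> finc f0 uc du.
have bar x a b : tau <= a -> a <= b -> b <= T -> x <= u a ->
    (forall s, a <= s < b -> 0 < f (s, x)) -> x <= u b.
  move=> taua leab leb xa fx.
  suff : x + 0 * (b - a) <= u b by rewrite mul0r addr0.
  apply: (@curve_ge_line _ u a b) => //; last by rewrite leab lexx.
  move=> s sab; rewrite mul0r addr0 => E.
  exists (f (s, u s)); first by apply: du; lra.
  by rewrite E; exact: fx.
move=> a b taua leab leb; rewrite leNgt; apply/negP => ltba.
(* [f (_, u tau)] is positive from [tau] on, so [u] never falls below its initial level. *)
have xib : u tau <= u b.
  apply: (bar _ tau b) => //; first exact: le_trans leab.
  move=> s /andP[]; rewrite le_eqVlt => /predU1P[<-//|taus] _.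
  by apply: lt_trans f0 _; exact: finc.
pose x := (u a + u b) / 2.
have [bx xa] : u b < x /\ x < u a by rewrite /x; split; lra.
(* If [f (_, x)] is nonnegative somewhere before [a], it is positive from [a] on, and [u] cannot
   drop from above [x] to [u b < x]. Otherwise it is negative on [[tau, a[], and [u], starting at
   [u tau <= u b < x], cannot climb to [u a > x]. *)
have [[s [/andP[taus sa] fs]]|nex] :=
    pselect (exists s, tau <= s < a /\ 0 <= f (s, x)).
  suff : x <= u b by rewrite leNgt bx.
  apply: (bar _ a b) => //; first exact: ltW.
  move=> r /andP[ar _]; apply: le_lt_trans fs _; apply: finc; exact: lt_le_trans ar.
suff : u a <= x + 0 * (a - tau) by rewrite mul0r addr0 leNgt xa.
apply: (@curve_le_line _ u tau a) => //; last by rewrite taua lexx.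
  exact/ltW/(le_lt_trans xib).
move=> s /andP[taus sa]; rewrite mul0r addr0 => E.
exists (f (s, u s)).
  by apply: du; rewrite taus /=; apply: lt_le_trans sa _; exact: le_trans leb.
by rewrite E ltNge; apply/negP => fs; apply: nex; exists s; rewrite taus.
Qed.

(** * One Euler step between the two time shifts *)

(** At a contact point [(r, x)] the slope [d] differs from [f (r, x)] by less than [m], whereas the
    lower shift has slope at most [f (r, x) - m] and the upper one at least [f (r, x) + m]. Contact
    points lie in the band [[u tau, X]], so the error bound is only required there. *)
Lemma euler_step_trapped (R : realType) (f : R * R -> R) (u : R -> R)
    (tau T X delta m a b y d : R) :
  (forall x, {homo (fun t => f (t, x)) : s t / s < t}) ->
  continuous u -> {homo u : s t / s <= t} ->
  (forall t, t < tau -> right_derivative u t 0 /\ u t = u tau) ->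
  (forall t, tau <= t < T + delta -> right_derivative u t (f (t, u t))) ->
  u (T + delta) <= X ->
  0 < delta -> m <= f (tau, u tau) ->
  (forall t x, tau <= t <= T -> u tau <= x <= X ->
    m <= f (t + delta, x) - f (t, x)) ->
  tau <= a -> b <= T -> u (a - delta) <= y <= u (a + delta) ->
  (forall s, a <= s <= b -> u tau <= y + d * (s - a) <= X ->
    `|d - f (s, y + d * (s - a))| < m) ->
  forall s, a <= s <= b -> u (s - delta) <= y + d * (s - a) <= u (s + delta).
Proof.
move=> finc uc umono dul dur uX delta0 mf gap taua bT /andP[ya1 ya2] err.
have uge t : u tau <= u t.
  by have [/umono//|/dul[_ ->]] := leP tau t.
have ule t : t <= T + delta -> u t <= X by move=> /umono /le_trans; exact.
have shiftc c : continuous (fun t => u (t + c)).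
  move=> t; apply: continuous_comp; last exact: uc.
  by apply: cvgD; [exact: cvg_id|exact: cvg_cst].
move=> s sab; apply/andP; split.
- apply: (@curve_le_line _ (fun t => u (t - delta)) a b) => // r rab E.
  have /err : a <= r <= b by lra.
  rewrite -E uge ule; last by lra.
  move=> /(_ isT); rewrite ltr_norml => /andP[err1 _].
  have [taur|rtau] := leP tau (r - delta).
    exists (f (r - delta, u (r - delta))).
      by apply: right_derivative_shift; apply: dur; lra.
    have := gap (r - delta) (u (r - delta)); rewrite subrK uge ule; last by lra.
    by move=> /(_ _ isT) => G; have := G ltac:(lra); lra.
  (* On the flat part left of [tau], the gap comes from [m <= f (tau, u tau) <= f (r, u tau)],
     whence [d > 0]. *)
  have [du0 ueq] := dul _ rtau.
  exists 0; first exact: right_derivative_shift.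
  move: err1; rewrite ueq.
  have : f (tau, u tau) <= f (r, u tau).
    have : tau <= r by lra.
    by rewrite le_eqVlt => /predU1P[->//|/finc/ltW].
  by move: mf; lra.
- apply: (@curve_ge_line _ (fun t => u (t + delta)) a b) => // r rab E.
  have /err : a <= r <= b by lra.
  rewrite -E uge ule; last by lra.
  move=> /(_ isT); rewrite ltr_norml => /andP[_ err1].
  exists (f (r + delta, u (r + delta))).
    by apply: right_derivative_shift; apply: dur; lra.
  have := gap r (u (r + delta)); rewrite uge ule; last by lra.
  by move=> /(_ _ isT) => G; have := G ltac:(lra); lra.
Qed.

(** * Extension of a path beyond an interval, and uniform continuity *)

(** Composition with [clamp a b] extends a path from [[a, b]] to the whole line by its endpoint
    values, so that continuity becomes global and time shifts make sense near the endpoints. *)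
Definition clamp (R : realType) (a b t : R) : R := Num.min (Num.max t a) b.

Lemma clamp_itv (R : realType) (a b t : R) : a <= b -> a <= clamp a b t <= b.
Proof. by move=> ab; rewrite /clamp le_min ge_min le_max !lexx ab !orbT. Qed.

Lemma clamp_id (R : realType) (a b t : R) : a <= t <= b -> clamp a b t = t.
Proof. by move=> /andP[? ?]; rewrite /clamp max_l// min_l. Qed.

Lemma clamp_le (R : realType) (a b t : R) : a <= b -> t <= a -> clamp a b t = a.
Proof. by move=> ? ?; rewrite /clamp max_r// min_l. Qed.

Lemma clamp_homo (R : realType) (a b : R) :
  a <= b -> {homo clamp a b : s t / s <= t}.
Proof.
move=> ab s t st; rewrite /clamp le_min !ge_min lexx orbT andbT.
by rewrite ge_max !le_max st lexx orbT.
Qed.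

Lemma continuous_clamp (R : realType) (a b : R) : continuous (@clamp R a b).
Proof.
move=> t; apply: (@continuous_min R R (fun t => Num.max t a) (fun=> b) t).
  by apply: (@continuous_max R R id (fun=> a) t); [exact: cvg_id|exact: cvg_cst].
exact: cvg_cst.
Qed.

Lemma has_derivative_within_continuous (R : realType) (D : set R)
    (phi : R -> R) (t d : R) :
  has_derivative_within D phi t d ->
  phi s @[s --> within D (nbhs t)] --> phi t.
Proof.
move=> dphi.
have lim : phi s @[s --> within D t^'] --> phi t.
  have st0 : s - t @[s --> within D t^'] --> (0 : R).
    rewrite -[X in _ --> X](subrr t); apply: cvgB; last exact: cvg_cst.
    by move=> P tP; apply: filterS (tP : nbhs t P).
  have : phi t + (phi s - phi t) / (s - t) * (s - t) @[s --> within D t^'] --> phi t + d * 0.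
    by apply: cvgD; [exact: cvg_cst|exact: cvgM].
  rewrite mulr0 addr0; apply: cvg_trans; apply: near_eq_cvg.
  have : \forall s \near t^', s != t by exact: nbhs_dnbhs_neq.
  apply: filterS => s st _.
  by rewrite divfK ?subr_eq0// addrC subrK.
move=> P phitP.
have near_ne : \forall s \near t, s != t -> D s -> P (phi s) := lim P phitP.
change (\forall s \near t, D s -> P (phi s)).
apply: filterS near_ne => s Ps Ds; have [->|st] := eqVneq s t; first exact: nbhs_singleton phitP.
exact: Ps.
Qed.

Lemma continuous_comp_clamp (R : realType) (D : set R) (phi dphi : R -> R) (a b : R) :
  a <= b -> (forall t, a <= t <= b -> D t) ->
  (forall t, D t -> has_derivative_within D phi t (dphi t)) ->
  continuous (phi \o clamp a b).
Proof.
move=> ab abD dD t.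
apply: cvg_comp; last first.
  by apply: has_derivative_within_continuous; apply: dD; apply: abD; exact: clamp_itv.
move=> P /= DP.
have : \forall s \near t, D (clamp a b s) -> P (clamp a b s).
  exact: (@continuous_clamp R a b t _ DP).
by apply: filterS => s; apply; apply: abD; exact: clamp_itv.
Qed.

Lemma right_derivative_comp_clamp (R : realType) (D : set R) (phi : R -> R) (a b t d : R) :
  (forall t, a <= t <= b -> D t) -> a <= t < b ->
  has_derivative_within D phi t d ->
  right_derivative (phi \o clamp a b) t d.
Proof.
move=> abD /andP[at_ tb] dphi.
have tb0 : 0 < b - t by rewrite subr_gt0.
(* Since [t < b], translation by a small [e > 0] stays in [[a, b]], hence in [D], and avoids [t]. *)
have lim : t + e @[e --> (0 : R)^'+] --> within D t^'.
  move=> P tP.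
  have {}tP : \forall s \near t, s != t -> D s -> P s := tP.
  have {}tP : \forall s \near t^'+, s != t -> D s -> P s by exact: cvg_within tP.
  have {}tP := iffLR (nbhs_right0P _ _) tP.
  change (\forall e \near (0 : R)^'+, P (t + e)); near=> e.
  have e0 : 0 < e by near: e; exact: nbhs_right_gt.
  have eb : e < b - t by near: e; exact: nbhs_right_lt.
  have : t + e != t -> D (t + e) -> P (t + e) by near: e; exact: tP.
  apply; last by apply: abD; lra.
  by rewrite -subr_eq0 addrAC subrr add0r gt_eqF.
apply: cvg_trans (cvg_comp _ _ lim dphi); apply: near_eq_cvg.
near=> e => /=.
have e0 : 0 < e by near: e; exact: nbhs_right_gt.
have eb : e < b - t by near: e; exact: nbhs_right_lt.
by rewrite !clamp_id ?(addrC t e) ?addrK//; lra.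
Unshelve. all: by end_near. Qed.

(** Only [x] is confined to [K]; [y] may leave it. This serves Euler lines leaving the rectangle and
    shifted times outside [[tau, T]]. *)
Lemma compact_unif_continuous (R : realType) (T : pseudoMetricType R) (f : T -> R)
    (K : set T) :
  compact K -> continuous f -> forall e, 0 < e ->
  exists2 d, 0 < d & forall x y, K x -> ball x d y -> `|f x - f y| < e.
Proof.
move=> /compact_near_coveringP Kc fc e e0.
have e20 : 0 < e / 2 by rewrite divr_gt0.
have : \forall d \near (0 : R)^'+, K `<=` [set x | forall y, ball x d y -> `|f x - f y| < e].
  apply: Kc => x _.
  have /cvgrPdist_lt/(_ _ e20)/nbhs_ballP[r /= r0 fr] := fc x.
  (* With half radii, both [x'] and a point [y] close to it lie in the ball of radius [r] on which
     [f] is within [e / 2] of [f x]. *)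
  exists (ball x (r / 2), [set d | d < r / 2]).
    split => /=; first by apply: nbhsx_ballx; rewrite divr_gt0.
    by apply: nbhs_right_lt; rewrite divr_gt0.
  move=> [x' d] [/= xx' dr] y x'y.
  have fx' : `|f x - f x'| < e / 2.
    by apply: fr; apply: le_ball xx'; lra.
  have fy : `|f x - f y| < e / 2.
    apply: fr; rewrite (splitr r); apply: ball_triangle xx' _.
    by apply: le_ball x'y; exact: ltW.
  rewrite -(subrKA (f x)) [e]splitr (le_lt_trans (ler_normD _ _))// ltrD//.
  by rewrite distrC.
move=> /(filterI (nbhs_right_gt (0 : R)))/filter_ex[d [d0 Kd]].
by exists d => // x y Kx; exact: Kd.
Qed.

(** * Trapping of the whole polygon *)

(** Induction over the nodes: the trap at [p k] puts [phin (p k)] in [[u tau, X]], where the error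
    bound applies, and the one-step lemma carries the trap to the next node. *)
Lemma euler_polygon_trapped (R : realType) (f fn : R * R -> R) (u phin : R -> R)
    (p : nat -> R) (tau T X delta m : R) :
  (forall x, {homo (fun t => f (t, x)) : s t / s < t}) ->
  continuous u -> {homo u : s t / s <= t} ->
  (forall t, t < tau -> right_derivative u t 0 /\ u t = u tau) ->
  (forall t, tau <= t < T + delta -> right_derivative u t (f (t, u t))) ->
  u (T + delta) <= X ->
  0 < delta -> m <= f (tau, u tau) ->
  (forall t x, tau <= t <= T -> u tau <= x <= X ->
    m <= f (t + delta, x) - f (t, x)) ->
  is_partition tau p -> euler_polygon fn tau (u tau) p phin ->
  (forall k s (y := phin (p k)) (d := fn (p k, y)), tau <= p k ->
    p k <= s <= p k.+1 -> s <= T -> u tau <= y <= X ->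
    u tau <= y + d * (s - p k) <= X ->
    `|d - f (s, y + d * (s - p k))| < m) ->
  forall t, tau <= t <= T -> u (t - delta) <= phin t <= u (t + delta).
Proof.
move=> finc uc umono dul dur uX delta0 mf gap [p0 pS punb] [phi0 phiS] err.
have taup k : tau <= p k.
  by elim: k => [|k IH]; [rewrite p0|exact: le_trans IH (ltW (pS k))].
have uge t : u tau <= u t.
  by have [/umono//|/dul[_ ->]] := leP tau t.
have step k : u (p k - delta) <= phin (p k) <= u (p k + delta) ->
    forall t, p k <= t <= p k.+1 -> t <= T ->
    u (t - delta) <= phin t <= u (t + delta).
  move=> trap t /andP[pkt tpk] tT.
  have -> : phin t = phin (p k) + fn (p k, phin (p k)) * (t - p k).
    move: pkt; rewrite le_eqVlt => /predU1P[->|pkt]; first by rewrite subrr mulr0 addr0.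
    by rewrite mulrC; apply: phiS; rewrite pkt.
  (* The step ends at [t] rather than at [p k.+1], which may lie beyond [T]. *)
  apply: (@euler_step_trapped R f u tau T X delta m (p k) t) => //; last by rewrite pkt lexx.
  move=> s /andP[pks st] yX; apply: err => //; [|exact: le_trans tT|].
    by rewrite pks (le_trans st).
  have /andP[y1 y2] := trap.
  rewrite (le_trans (uge _) y1) (le_trans y2)// (le_trans _ uX)//.
  by apply: umono; rewrite lerD2r (le_trans pkt).
have nodes k : p k <= T -> u (p k - delta) <= phin (p k) <= u (p k + delta).
  elim: k => [_|k IH pT].
    rewrite p0 phi0 uge andbT (umono (tau - delta))//; lra.
  by apply: (step k) => //; [apply: IH; exact: le_trans (ltW (pS k)) pT|rewrite lexx ltW].
move=> t /andP[taut tT].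
(* The first node beyond [t] has positive index because [p 0 = tau <= t]; by minimality its
   predecessor is at most [t]. *)
have ex := punb t; case: (ex_minnP ex) => -[|k] ltk mink.
  by move: ltk; rewrite p0 ltNge taut.
have pkt : p k <= t by rewrite leNgt; apply/negP => /mink; rewrite ltnn.
by apply: (step k) => //; [apply: nodes; exact: le_trans tT|rewrite pkt ltW].
Qed.

(** * Norms and meshes in the extended reals *)

(** Real upper bounds make the terms eventually finite, so convergence can be checked on their real
    values. *)
Lemma cvge0_le (R : realType) (v : nat -> \bar R) :
  (forall n, 0 <= v n)%E ->
  (forall e : R, 0 < e -> \forall n \near \oo, (v n <= e%:E)%E) ->
  v n @[n --> \oo] --> 0%E.
Proof.
move=> v0 vle.
have vfin e n : (v n <= e%:E)%E -> v n \is a fin_num.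
  by move=> vn; rewrite ge0_fin_numE// (le_lt_trans vn) ?ltry.
apply/fine_cvgP; split.
  by apply: filterS (vle 1 ltr01) => n /vfin.
apply/cvgrPdist_le => e e0; apply: filterS (vle e e0) => n vn /=.
by rewrite sub0r normrN ger0_norm ?fine_ge0// -lee_fin fineK// (vfin e).
Qed.

Lemma sup_norm_ge0 (R : realType) (T : Type) (A : set T) (f : T -> R) (x : T) :
  A x -> (0 <= sup_norm A f)%E.
Proof.
move=> Ax; apply: (@le_trans _ _ `|f x|%:E); first by rewrite lee_fin.
by apply: ereal_sup_ubound; exists x.
Qed.

Lemma sup_norm_lt (R : realType) (T : Type) (A : set T) (f : T -> R) (c : R) :
  (sup_norm A f < c%:E)%E -> forall x, A x -> `|f x| < c.
Proof.
move=> fc x Ax; rewrite -lte_fin; apply: le_lt_trans fc.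
by apply: ereal_sup_ubound; exists x.
Qed.

Lemma sup_norm_le (R : realType) (T : Type) (A : set T) (f : T -> R) (c : R) :
  (forall x, A x -> `|f x| <= c) -> (sup_norm A f <= c%:E)%E.
Proof. by move=> fc; apply: ge_ereal_sup => _ [x Ax <-]; rewrite lee_fin fc. Qed.

Lemma mesh_lt (R : realType) (p : nat -> R) (T r : R) (k : nat) (s : R) :
  (mesh p T < r%:E)%E -> p k <= s <= p k.+1 -> s <= T -> s - p k < r.
Proof.
move=> pr /andP[pks spk] sT; rewrite -lte_fin; apply: le_lt_trans pr.
apply: (@le_trans _ _ (Num.min (p k.+1) T - Num.min (p k) T)%:E).
  rewrite lee_fin lerB//; first by rewrite le_min spk.
  by rewrite ge_min lexx.
by apply: ereal_sup_ubound; exists k.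
Qed.

(** * Uniform estimates on the rectangle *)

(** Half of [m] pays for replacing [f] by [fn] at the node, the other half for the variation of [f]
    along the Euler line. The slope of that line is bounded uniformly, so [r] can be chosen before
    [fn] and [p]. *)
Lemma euler_consistency (R : realType) (f : R * R -> R) (tau T xi X m : R) :
  continuous f -> 0 < m ->
  exists2 r, 0 < r & forall (fn : R * R -> R) (p : nat -> R),
    (sup_norm (`[tau, T] `*` `[xi, X]) (f \- fn)%R < (m / 2)%:E)%E ->
    (mesh p T < r%:E)%E ->
    forall k s y (d := fn (p k, y)), tau <= p k ->
      p k <= s <= p k.+1 -> s <= T -> xi <= y <= X ->
      `|d - f (s, y + d * (s - p k))| < m.
Proof.
move=> fc m0; pose K : set (R * R) := `[tau, T] `*` `[xi, X].
have Kc : compact K by apply: compact_setX; exact: segment_compact.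
have m20 : 0 < m / 2 by rewrite divr_gt0.
have [eta eta0 feta] := compact_unif_continuous Kc fc m20.
(* The rectangle may be empty, in which case [M = 0] serves. *)
have [M M0 fM] : exists2 M, 0 <= M & forall z, K z -> `|f z| <= M.
  have [K0|/set0P/negP/negPn/eqP K0] := pselect (K !=set0); last first.
    by exists 0 => // z; rewrite K0.
  have [|z _ zmax] := compact_EVT_max K0 Kc (f := fun z => `|f z|).
    by apply: continuous_subspaceT => z; apply: cvg_norm; exact: fc.
  by exists `|f z| => // z' Kz'; apply: zmax; rewrite inE.
have M10 : 0 < M + m + 1 by lra.
(* [M + m] bounds [|d|], and the additional 1 makes the factor exceed 1, so that
   [(s - p k) * (M + m + 1) < eta] controls the displacement in time as well as in space. *)
exists (eta / (M + m + 1)); first by rewrite divr_gt0.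
move=> fn p fnm pr k s y d taup psp sT yX.
have Kpy : K (p k, y).
  have /andP[pks _] := psp.
  by split; rewrite /= in_itv /= ?taup ?yX//= (le_trans pks).
have ffn : `|f (p k, y) - d| < m / 2 by exact: (sup_norm_lt fnm Kpy).
have sp : (s - p k) * (M + m + 1) < eta by rewrite -ltr_pdivlMr//; exact: mesh_lt psp sT.
have sp0 : 0 <= s - p k by rewrite subr_ge0; case/andP: psp.
have dM : `|d| <= M + m.
  have -> : d = f (p k, y) - (f (p k, y) - d) by rewrite opprB addrC subrK.
  apply: le_trans (ler_normB _ _) _; apply: lerD; first exact: fM.
  by apply: ltW; apply: lt_trans ffn _; lra.
have ballz : ball (p k, y) eta (s, y + d * (s - p k)).
  split; rewrite /= /ball /=.
    rewrite distrC ger0_norm//; apply: le_lt_trans sp.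
    by rewrite ler_peMr//; lra.
  rewrite opprD addrA subrr sub0r normrN normrM (ger0_norm sp0) mulrC.
  apply: le_lt_trans sp; apply: ler_wpM2l => //; lra.
have := feta _ _ Kpy ballz.
rewrite -(subrKA (f (p k, y)) d) => fe.
rewrite (le_lt_trans (ler_normD _ _))// [m]splitr ltrD//.
by rewrite distrC.
Qed.

(** The difference attains its minimum on the compact rectangle, and strict monotonicity makes it
    positive there. *)
Lemma time_shift_gap (R : realType) (f : R * R -> R) (tau T xi X delta : R) :
  continuous f -> (forall x, {homo (fun t => f (t, x)) : s t / s < t}) ->
  0 < delta -> tau <= T -> xi <= X ->
  exists2 m, 0 < m & forall t x, tau <= t <= T -> xi <= x <= X ->
    m <= f (t + delta, x) - f (t, x).
Proof.
move=> fc finc delta0 tauT xiX.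
pose K : set (R * R) := `[tau, T] `*` `[xi, X].
have Kc : compact K by apply: compact_setX; exact: segment_compact.
have K0 : K !=set0 by exists (tau, xi); split; rewrite /= in_itv /= ?lexx ?tauT ?xiX.
have [|[t0 x0] _ gmin] :=
    compact_EVT_min K0 Kc (f := fun z => f (z.1 + delta, z.2) - f z).
  apply: continuous_subspaceT => z; apply: cvgB; last exact: fc.
  apply: (@continuous_comp _ _ _ (fun z : R * R => (z.1 + delta, z.2)) f); last exact: fc.
  apply: (@cvg_pair _ _ _ _ (nbhs (z.1 + delta)) (nbhs z.2)); last exact: cvg_snd.
  by apply: cvgD; [exact: cvg_fst|exact: cvg_cst].
exists (f (t0 + delta, x0) - f (t0, x0)).
  by rewrite subr_gt0 finc// ltrDl.
by move=> t x tI xI; apply: (gmin (t, x)); rewrite inE; split; rewrite /= in_itv.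
Qed.

(** * Convergence of the polygons *)

Theorem mainTheorem4 (R : realType) (tau xi : R)
    (f : nat -> R * R -> R) (p : nat -> nat -> R) (phi : nat -> R -> R)
    (T0 : \bar R) :
  (forall n, classF R (f n)) ->
  (forall n, 0 < f n (tau, xi)) ->
  (forall n, (0 < n)%N -> is_partition tau (p n)) ->
  (forall n, (0 < n)%N -> euler_polygon (f n) tau xi (p n) (phi n)) ->
  maximal_solution (f 0%N) tau xi T0 (phi 0%N) ->
  forall T X : R, tau < T -> (T%:E < T0)%E -> phi 0%N T < X ->
  (sup_norm (`[tau, T] `*` `[xi, X]) (f 0%N \- f n), mesh (p n) T)
    @[n --> \oo] --> (0%E, 0%E) ->
  sup_norm `[tau, T] (phi 0%N \- phi n) @[n --> \oo] --> 0%E.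
Proof.
move=> Ff fpos part euler [_ _ phi0tau dphi _] T X tauT TT0 phiX conv.
have [fc finc _] := Ff 0%N.
(* [T1] leaves room beyond [T] for the forward shift of the solution. *)
have [T1 TT1 T1T0] : exists2 T1, T < T1 & (T1%:E < T0)%E.
  case: T0 TT0 {dphi} => [T0||//]; last by exists (T + 1); rewrite ?ltry ?ltrDl.
  by rewrite lte_fin => /midf_lt[]; exists ((T + T0) / 2); rewrite ?lte_fin.
have tauT1 : tau < T1 := lt_trans tauT TT1.
pose D := forward_itv tau T0.
have DI t : tau <= t <= T1 -> D t.
  by move=> /andP[? tT1]; split=> //; apply: le_lt_trans T1T0; rewrite lee_fin.
pose u := phi 0%N \o clamp tau T1.
have uE t : tau <= t <= T1 -> u t = phi 0%N t by move=> tI; rewrite /u /= clamp_id.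
have utau : u tau = xi by rewrite uE ?lexx ?(ltW tauT1).
have uc : continuous u by exact: (continuous_comp_clamp (ltW tauT1) DI dphi).
have dur t : tau <= t < T1 -> right_derivative u t (f 0%N (t, u t)).
  move=> tI; have tI' : tau <= t <= T1 by case/andP: tI => -> /ltW.
  rewrite uE//; apply: (right_derivative_comp_clamp DI tI); apply: dphi; exact: DI.
have dul t : t < tau -> right_derivative u t 0 /\ u t = u tau.
  move=> ttau; have ult s : s <= tau -> u s = u tau.
    by move=> stau; rewrite /u /= !(clamp_le (ltW tauT1)).
  split; last exact/ult/ltW.
  have : (0 : R) @[_ --> (0 : R)^'+] --> (0 : R) by exact: cvg_cst.
  apply: cvg_trans; apply: near_eq_cvg; near=> e.
  have te : t + e <= tau.
    by rewrite -lerBrDl; near: e; apply: nbhs_right_le; rewrite subr_gt0.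
  by rewrite (ult _ te) (ult _ (ltW ttau)) subrr mul0r.
have umono : {homo u : s t / s <= t}.
  (* Clamping the argument does not change [u], so monotonicity need only be checked on
     [[tau, T1]]. *)
  have uclamp s : u s = u (clamp tau T1 s).
    by rewrite /u /= [in RHS]clamp_id// clamp_itv// ltW.
  have u0 : 0 < f 0%N (tau, u tau) by rewrite utau.
  move=> s t st; rewrite (uclamp s) (uclamp t).
  have /andP[s1 _] := clamp_itv s (ltW tauT1).
  have /andP[_ t2] := clamp_itv t (ltW tauT1).
  apply: (solution_nondecreasing finc u0 uc dur) => //.
  exact: clamp_homo (ltW tauT1) _ _ st.
apply: cvge0_le => [n|eps eps0].
  by apply: (@sup_norm_ge0 _ _ _ _ tau); rewrite /= in_itv /= lexx ltW.
have [d0 d00 ud0] := compact_unif_continuous (@segment_compact _ tau T) uc eps0.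
(* The margin [phi 0 T < X] keeps the upper shift below [X] up to time [T]. *)
have uTX : \forall e \near (0 : R)^'+, u (T + e) < X.
  have uTX : \forall s \near T, u s < X.
    by have /cvgr_lt := uc T; apply; rewrite uE ?(ltW tauT)// ltW.
  have {}uTX : \forall s \near T^'+, u s < X by exact: cvg_within uTX.
  exact: (iffLR (nbhs_right0P T _) uTX).
have [delta [delta0 deltad0 deltaT uX]] :
    exists delta, [/\ 0 < delta, delta < d0, T + delta <= T1 & u (T + delta) <= X].
  near (0 : R)^'+ => delta; exists delta; split.
  - by near: delta; exact: nbhs_right_gt.
  - by near: delta; exact: nbhs_right_lt.
  - by rewrite -lerBrDl; near: delta; apply: nbhs_right_le; rewrite subr_gt0.
  - by apply: ltW; near: delta.
have uge t : xi <= u t.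
  by rewrite -utau; have [/umono//|/dul[_ ->]] := leP tau t.
have xiX : xi <= X by rewrite (le_trans (uge _) uX).
have [m' m'0 gap] := time_shift_gap fc finc delta0 (ltW tauT) xiX.
(* The second term is the gap for the constant part of [u] left of [tau], where the lower shift has
   slope 0. *)
pose m := Num.min m' (f 0%N (tau, xi)).
have m0 : 0 < m by rewrite lt_min m'0 fpos.
have [r r0 err] := euler_consistency tau T xi X fc m0.
have near_f : \forall n \near \oo,
    (sup_norm (`[tau, T] `*` `[xi, X]) (f 0%N \- f n)%R < (m / 2)%:E)%E.
  have m20 : (0 < (m / 2)%:E)%E by rewrite lte_fin divr_gt0.
  have lim : sup_norm (`[tau, T] `*` `[xi, X]) (f 0%N \- f n) @[n --> \oo] --> 0%E.
    exact: (cvg_comp _ fst conv (@cvg_fst _ _ (nbhs (0%E : \bar R)) (nbhs (0%E : \bar R)) _)).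
  exact: lim (open_ereal_lt' m20).
have near_mesh : \forall n \near \oo, (mesh (p n) T < r%:E)%E.
  have r0E : (0 < r%:E)%E by rewrite lte_fin.
  have lim : mesh (p n) T @[n --> \oo] --> 0%E.
    exact: (cvg_comp _ snd conv (@cvg_snd _ _ (nbhs (0%E : \bar R)) (nbhs (0%E : \bar R)) _)).
  exact: lim (open_ereal_lt' r0E).
near=> n.
have n0 : (0 < n)%N by near: n; exact: nbhs_infty_gt.
apply: sup_norm_le => t /=; rewrite in_itv /= => tI.
have /andP[low up] : u (t - delta) <= phi n t <= u (t + delta).
  apply: (@euler_polygon_trapped _ (f 0%N) (f n) u (phi n) (p n) tau T X delta m) => //.
  - by move=> s /andP[taus sT]; apply: dur; rewrite taus (lt_le_trans sT).
  - by rewrite utau /m ge_min lexx orbT.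
  - by move=> s x sI; rewrite utau => xI; rewrite /m ge_min gap.
  - exact: part.
  - by rewrite utau; exact: euler.
  - rewrite utau => k s y d taup psp sT yX _.
    by apply: err => //; near: n.
(* Both shifts are within [eps] of [u t], hence so is [phi n t] between them. *)
have tb c : `|c| < d0 -> `|u t - u (t + c)| < eps.
  move=> cd; apply: ud0; first by rewrite /= in_itv.
  by rewrite /ball /= opprD addrA subrr sub0r normrN.
have := tb delta; have := tb (- delta).
rewrite normrN gtr0_norm// => /(_ deltad0) + /(_ deltad0).
rewrite !ltr_norml -(uE t); last first.
  by case/andP: tI => -> tT; rewrite (le_trans tT)// ltW.
rewrite ler_norml; lra.
Unshelve. all: by end_near. Qed.
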